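(* Let $\mathcal{A}$ be a tensor category over $k$ and let $\mathcal{C}$ be a Serre subcategory of $\mathcal{A}$. Suppose that $\mathcal{A}/\mathcal{C}$ is equipped with some monoidal structure for which the canonical functor $T:\mathcal{A}\to\mathcal{A}/\mathcal{C}$ is a monoidal functor. Then $\mathcal{C}$ is trivial, i.e. either $\mathcal{C}=0$ or $\mathcal{C}=\mathcal{A}$.
   Context: $k$ is an algebraically closed field. A $k$-linear abelian category is locally finite if all its Hom spaces are finite dimensional over $k$ and every object has finite length. A multitensor category over $k$ is a locally finite $k$-linear abelian rigid monoidal category with bilinear tensor product (which is then automatically biexact). A tensor category is a multitensor category $\mathcal{A}$ with $\mathrm{End}_{\mathcal{A}}(1)=k$ that is indecomposable, i.e. not equivalent to a direct sum of nonzero multitensor categories. A Serre subcategory of an abelian category is a full additive subcategory closed under subobjects, quotients and extensions. The quotient category $\mathcal{A}/\mathcal{C}$ has the same objects as $\mathcal{A}$, and $\mathrm{Hom}_{\mathcal{A}/\mathcal{C}}(M,N)=\varinjlim_{M',N'}\mathrm{Hom}_{\mathcal{A}}(M',N/N')$, where $M'\subset M$ and $N'\subset N$ run over the subobjects with $M/M'\in\mathcal{C}$ and $N'\in\mathcal{C}$; $T$ is the canonical functor, which is the identity on objects. Monoidal functors are strong: $T(X\otimes Y)\cong T(X)\otimes T(Y)$ naturally and coherently, and $T(1)$ is isomorphic to the unit object. The monoidal structure on $\mathcal{A}/\mathcal{C}$ is arbitrary, not assumed to be any particular one. $\mathcal{C}=0$ means that $\mathcal{C}$ contains only zero objects. 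*)

(* Defs.v *)
From HB Require Import structures.
From mathcomp Require Import all_boot all_algebra.
From mathcomp Require Import boolp.

Set Implicit Arguments.
Unset Strict Implicit.
Unset Printing Implicit Defensive.

Import GRing.Theory.
Local Open Scope ring_scope.
Local Open Scope quotient_scope.

Declare Scope cat_scope.
Delimit Scope cat_scope with cat.
Local Open Scope cat_scope.

Record category := Category {
  ob :> Type;
  hom : ob -> ob -> Type;
  idm : forall X, hom X X;
  comp : forall X Y Z, hom Y Z -> hom X Y -> hom X Z;
  comp_idl : forall X Y (f : hom X Y), comp (idm Y) f = f;
  comp_idr : forall X Y (f : hom X Y), comp f (idm X) = f;
  compA : forall W X Y Z (h : hom Y Z) (g : hom X Y) (f : hom W X),
    comp h (comp g f) = comp (comp h g) f }.

Arguments idm {c} X.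
Arguments comp {c X Y Z} g f.

Notation "g \cmp f" := (comp g f)
  (at level 40, left associativity) : cat_scope.

Section CategoryNotions.
Variable C : category.
Implicit Types X Y Z : C.

Definition mono X Y (f : hom X Y) : Prop :=
  forall Z (g h : hom Z X), f \cmp g = f \cmp h -> g = h.

Definition epi X Y (f : hom X Y) : Prop :=
  forall Z (g h : hom Y Z), g \cmp f = h \cmp f -> g = h.

Definition is_iso X Y (f : hom X Y) : Prop :=
  exists g : hom Y X, g \cmp f = idm X /\ f \cmp g = idm Y.

Record iso X Y := Iso {
  fwd :> hom X Y;
  bwd : hom Y X;
  fwdK : bwd \cmp fwd = idm X;
  bwdK : fwd \cmp bwd = idm Y }.

Definition is_zero_ob X : Prop :=
  forall Y, (exists! f : hom X Y, True) /\ (exists! f : hom Y X, True).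

End CategoryNotions.

Record functor (C D : category) := Functor {
  fob :> C -> D;
  fmap : forall X Y, hom X Y -> hom (fob X) (fob Y);
  fmap_id : forall X, fmap (idm X) = idm (fob X);
  fmap_comp : forall X Y Z (g : hom Y Z) (f : hom X Y),
    fmap (g \cmp f) = fmap g \cmp fmap f }.

Arguments fmap {C D} F {X Y} f : rename.

Definition fully_faithful (C D : category) (F : functor C D) : Prop :=
  forall X Y (g : hom (F X) (F Y)), exists! f : hom X Y, fmap F f = g.

Definition essentially_surjective (C D : category) (F : functor C D) : Prop :=
  forall Y : D, exists X : C, inhabited (iso (F X) Y).

Record monoidal (C : category) := Monoidal {
  tens : C -> C -> C;
  tensm : forall X X' Y Y', hom X X' -> hom Y Y' -> hom (tens X Y) (tens X' Y');
  munit : C;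
  assoc : forall X Y Z, iso (tens (tens X Y) Z) (tens X (tens Y Z));
  lunit : forall X, iso (tens munit X) X;
  runit : forall X, iso (tens X munit) X;
  tensm_id : forall X Y, tensm (idm X) (idm Y) = idm (tens X Y);
  tensm_comp : forall X X' X'' Y Y' Y''
      (g : hom X' X'') (f : hom X X') (g' : hom Y' Y'') (f' : hom Y Y'),
    tensm (g \cmp f) (g' \cmp f') = tensm g g' \cmp tensm f f';
  assoc_nat : forall X X' Y Y' Z Z' (f : hom X X') (g : hom Y Y') (h : hom Z Z'),
    assoc X' Y' Z' \cmp tensm (tensm f g) h
    = tensm f (tensm g h) \cmp assoc X Y Z;
  lunit_nat : forall X X' (f : hom X X'),
    lunit X' \cmp tensm (idm munit) f = f \cmp lunit X;
  runit_nat : forall X X' (f : hom X X'),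
    runit X' \cmp tensm f (idm munit) = f \cmp runit X;
  pentagon : forall W X Y Z,
    assoc W X (tens Y Z) \cmp assoc (tens W X) Y Z
    = tensm (idm W) (assoc X Y Z) \cmp assoc W (tens X Y) Z
      \cmp tensm (assoc W X Y) (idm Z);
  triangle : forall X Y,
    tensm (idm X) (lunit Y) \cmp assoc X munit Y = tensm (runit X) (idm Y) }.

Arguments tensm {C} m {X X' Y Y'} f g.

(* A strong monoidal functor: the unit of [D] is only required to be isomorphic
   to the image of the unit of [C]; given the coherent isomorphisms [mf_mul],
   there is then a unique such isomorphism compatible with the unit
   constraints. *)
Record monoidal_functor (C D : category) (MC : monoidal C) (MD : monoidal D)
    (F : functor C D) := MonoidalFunctor {
  mf_mul : forall X Y, iso (tens MD (F X) (F Y)) (F (tens MC X Y));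
  mf_unit : inhabited (iso (munit MD) (F (munit MC)));
  mf_mul_nat : forall X X' Y Y' (f : hom X X') (g : hom Y Y'),
    mf_mul X' Y' \cmp tensm MD (fmap F f) (fmap F g)
    = fmap F (tensm MC f g) \cmp mf_mul X Y;
  mf_mul_assoc : forall X Y Z,
    fmap F (assoc MC X Y Z) \cmp mf_mul (tens MC X Y) Z
      \cmp tensm MD (mf_mul X Y) (idm (F Z))
    = mf_mul X (tens MC Y Z) \cmp tensm MD (idm (F X)) (mf_mul Y Z)
      \cmp assoc MD (F X) (F Y) (F Z) }.

(* [Y] is a left dual of [X], equivalently [X] is a right dual of [Y].  The two
   zigzag identities are stated as morphisms with source 1 (x) X and Y (x) 1. *)
Definition is_left_dual (C : category) (M : monoidal C) (X Y : C) : Prop :=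
  exists (ev : hom (tens M Y X) (munit M)) (coev : hom (munit M) (tens M X Y)),
    runit M X \cmp tensm M (idm X) ev \cmp assoc M X Y X
      \cmp tensm M coev (idm X) = lunit M X
    /\ lunit M Y \cmp tensm M ev (idm Y) \cmp bwd (assoc M Y X Y)
      \cmp tensm M (idm Y) coev = runit M Y.

Definition is_rigid (C : category) (M : monoidal C) : Prop :=
  forall X : C, (exists Y, is_left_dual M X Y) /\ (exists Z, is_left_dual M Z X).

(* [GRing.Lmodule k T] is the type of [k]-vector space structures on [T]. *)
Record prelinear_category (k : fieldType) := PrelinearCategory {
  pl_cat :> category;
  pl_lmod : forall X Y : pl_cat, GRing.Lmodule k (hom X Y) }.

HB.instance Definition _ (k : fieldType) (A : prelinear_category k) (X Y : A) :=
  @pl_lmod k A X Y.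

Record linear_category (k : fieldType) := LinearCategory {
  lin_pre :> prelinear_category k;
  comp_linearl : forall (X Y Z : lin_pre) (f : hom X Y),
    linear (fun g : hom Y Z => g \cmp f);
  comp_linearr : forall (X Y Z : lin_pre) (g : hom Y Z),
    linear (fun f : hom X Y => g \cmp f) }.

Section LinearNotions.
Variables (k : fieldType) (A : linear_category k).
Implicit Types X Y Z : A.

Definition is_kernel X Y K (f : hom X Y) (i : hom K X) : Prop :=
  f \cmp i = 0 /\
  forall Z (g : hom Z X), f \cmp g = 0 -> exists! h : hom Z K, i \cmp h = g.

Definition is_cokernel X Y Q (f : hom X Y) (p : hom Y Q) : Prop :=
  p \cmp f = 0 /\
  forall Z (g : hom Y Z), g \cmp f = 0 -> exists! h : hom Q Z, h \cmp p = g.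

Definition is_biproduct X Y P (i1 : hom X P) (i2 : hom Y P)
    (p1 : hom P X) (p2 : hom P Y) : Prop :=
  [/\ p1 \cmp i1 = idm X, p2 \cmp i2 = idm Y, p1 \cmp i2 = 0, p2 \cmp i1 = 0
    & i1 \cmp p1 + i2 \cmp p2 = idm P].

Definition short_exact X Y Z (i : hom X Y) (p : hom Y Z) : Prop :=
  is_kernel p i /\ is_cokernel i p.

Record is_abelian : Prop := IsAbelian {
  abelian_zero : exists Z, is_zero_ob Z;
  abelian_biproduct : forall X Y, exists P (i1 : hom X P) (i2 : hom Y P) p1 p2,
    is_biproduct i1 i2 p1 p2;
  abelian_kernel : forall X Y (f : hom X Y), exists K (i : hom K X),
    is_kernel f i;
  abelian_cokernel : forall X Y (f : hom X Y), exists Q (p : hom Y Q),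
    is_cokernel f p;
  abelian_mono : forall X Y (f : hom X Y), mono f ->
    exists Z (g : hom Y Z), is_kernel g f;
  abelian_epi : forall X Y (f : hom X Y), epi f ->
    exists Z (g : hom Z X), is_cokernel g f }.

Definition hom_finite : Prop :=
  forall X Y, exists (n : nat) (b : 'I_n -> hom X Y),
  forall f : hom X Y, exists c : 'I_n -> k, f = \sum_(i < n) c i *: b i.

Definition simple X : Prop :=
  ~ is_zero_ob X /\
  forall Y (i : hom Y X), mono i -> is_zero_ob Y \/ is_iso i.

(* Existence of a finite composition series. *)
Inductive finite_length : A -> Prop :=
| finite_length0 X : is_zero_ob X -> finite_length X
| finite_lengthS X Y S (i : hom Y X) (p : hom X S) :
    short_exact i p -> simple S -> finite_length Y -> finite_length X.

Definition bilinear_tensor (M : monoidal A) : Prop :=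
  (forall X X' Y Y' (g : hom Y Y'),
     linear (fun f : hom X X' => tensm M f g : hom _ _)) /\
  (forall X X' Y Y' (f : hom X X'),
     linear (fun g : hom Y Y' => tensm M f g : hom _ _)).

End LinearNotions.

Definition linear_functor (k : fieldType) (A B : linear_category k)
    (F : functor A B) : Prop :=
  forall X Y : A, linear (fun f : hom X Y => fmap F f : hom (F X) (F Y)).

Record abelian_category (k : fieldType) := AbelianCategory {
  ab_lin :> linear_category k;
  abelianP : is_abelian ab_lin }.

Record multitensor_category (k : closedFieldType) := MultitensorCategory {
  mt_ab :> abelian_category k;
  mt_mon : monoidal mt_ab;
  mt_hom_finite : hom_finite mt_ab;
  mt_finite_length : forall X : mt_ab, finite_length X;
  mt_bilinear : bilinear_tensor mt_mon;
  mt_rigid : is_rigid mt_mon }.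

Section DirectSum.

Definition prod_category (C D : category) : category.
Proof.
refine (@Category (C * D)%type (fun X Y => (hom X.1 Y.1 * hom X.2 Y.2)%type)
  (fun X => (idm X.1, idm X.2))
  (fun X Y Z g f => (g.1 \cmp f.1, g.2 \cmp f.2)) _ _ _).
- by move=> X Y [f g] /=; rewrite !comp_idl.
- by move=> X Y [f g] /=; rewrite !comp_idr.
- by move=> W X Y Z [h h'] [g g'] [f f'] /=; rewrite !compA.
Defined.

Definition prod_iso (C D : category) (X Y : C) (X' Y' : D)
  (u : iso X Y) (v : iso X' Y') :
  @iso (prod_category C D) (X, X') (Y, Y').
Proof.
refine (@Iso (prod_category C D) (X, X') (Y, Y')
  (fwd u, fwd v) (bwd u, bwd v) _ _); by rewrite /= ?fwdK ?bwdK.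
Defined.

Definition prod_monoidal (C D : category) (M : monoidal C) (N : monoidal D) :
  monoidal (prod_category C D).
Proof.
refine (@Monoidal (prod_category C D)
  (fun X Y => (tens M X.1 Y.1, tens N X.2 Y.2))
  (fun X X' Y Y' f g => (tensm M f.1 g.1, tensm N f.2 g.2))
  (munit M, munit N)
  (fun X Y Z => prod_iso (assoc M X.1 Y.1 Z.1) (assoc N X.2 Y.2 Z.2))
  (fun X => let: (X1, X2) := X in prod_iso (lunit M X1) (lunit N X2))
  (fun X => let: (X1, X2) := X in prod_iso (runit M X1) (runit N X2))
  _ _ _ _ _ _ _).
- by move=> X Y /=; rewrite !tensm_id.
- by move=> * /=; rewrite !tensm_comp.
- by move=> * /=; rewrite !assoc_nat.
- by move=> [X1 X2] [Y1 Y2] [f1 f2] /=; rewrite !lunit_nat.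
- by move=> [X1 X2] [Y1 Y2] [f1 f2] /=; rewrite !runit_nat.
- by move=> * /=; rewrite !pentagon.
- by move=> [X1 X2] [Y1 Y2] /=; rewrite !triangle.
Defined.

Definition prod_prelinear (k : fieldType) (A B : linear_category k) :
    prelinear_category k :=
  @PrelinearCategory k (prod_category A B)
    (fun X Y => GRing.Lmodule.on (hom X.1 Y.1 * hom X.2 Y.2)%type).

Definition prod_linear (k : fieldType) (A B : linear_category k) :
  linear_category k.
Proof.
refine (@LinearCategory k (prod_prelinear A B) _ _).
- move=> X Y Z f a g h; apply: (@eq_trans _ _
    (a *: (g.1 \cmp f.1) + h.1 \cmp f.1, a *: (g.2 \cmp f.2) + h.2 \cmp f.2)) => //.
  by rewrite -!(comp_linearl _ _).
- move=> X Y Z f a g h; apply: (@eq_trans _ _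
    (a *: (f.1 \cmp g.1) + f.1 \cmp h.1, a *: (f.2 \cmp g.2) + f.2 \cmp h.2)) => //.
  by rewrite -!(comp_linearr _ _).
Defined.

End DirectSum.

(* A direct sum of more than two nonzero multitensor categories is also a direct
   sum of two of them, so binary direct sums suffice; equivalences are
   [k]-linear and monoidal. *)
Definition indecomposable (k : closedFieldType) (A : multitensor_category k) :
    Prop :=
  forall B1 B2 : multitensor_category k,
    ~ (forall X : B1, is_zero_ob X) -> ~ (forall X : B2, is_zero_ob X) ->
    ~ exists F : functor A (prod_linear B1 B2),
      [/\ linear_functor F, fully_faithful F, essentially_surjective F
        & inhabited (monoidal_functor (mt_mon A)
            (prod_monoidal (mt_mon B1) (mt_mon B2)) F)].

Record tensor_category (k : closedFieldType) := TensorCategory {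
  tc_mt :> multitensor_category k;
  tc_end : forall f : hom (munit (mt_mon tc_mt)) (munit (mt_mon tc_mt)),
    exists! c : k, f = c *: (idm _ : hom _ _);
  tc_indecomposable : indecomposable tc_mt }.

(* A full subcategory is given by the class of its objects. *)
Record serre_subcategory (k : fieldType) (A : abelian_category k) :=
  SerreSubcategory {
  serre_mem :> A -> Prop;
  serre_zero : forall X : A, is_zero_ob X -> serre_mem X;
  serre_biproduct : forall (X Y P : A) i1 i2 (p1 : hom P X) (p2 : hom P Y),
    is_biproduct i1 i2 p1 p2 -> serre_mem X -> serre_mem Y -> serre_mem P;
  serre_sub : forall (X Y : A) (i : hom Y X),
    mono i -> serre_mem X -> serre_mem Y;
  serre_quo : forall (X Y : A) (p : hom X Y),
    epi p -> serre_mem X -> serre_mem Y;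
  serre_ext : forall (X Y Z : A) (i : hom X Y) (p : hom Y Z),
    short_exact i p -> serre_mem X -> serre_mem Z -> serre_mem Y }.

Section AbelianFacts.
Variables (k : fieldType) (A : abelian_category k).
Implicit Types X Y Z : A.

Lemma comp0l X Y Z (f : hom X Y) : (0 : hom Y Z) \cmp f = 0.
Proof.
have := comp_linearl (Z := Z) f (- 1) 0 0.
by rewrite !scaleN1r oppr0 addr0 addNr.
Qed.

Lemma comp0r X Y Z (f : hom Y Z) : f \cmp (0 : hom X Y) = 0.
Proof.
have := comp_linearr (X := X) f (- 1) 0 0.
by rewrite !scaleN1r oppr0 addr0 addNr.
Qed.

Lemma compBl X Y Z (f : hom X Y) (g h : hom Y Z) :
  (g - h) \cmp f = g \cmp f - h \cmp f.
Proof.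
by have := comp_linearl f (- 1) h g; rewrite !scaleN1r ![- _ + _]addrC.
Qed.

Lemma compBr X Y Z (f : hom Y Z) (g h : hom X Y) :
  f \cmp (g - h) = f \cmp g - f \cmp h.
Proof.
by have := comp_linearr f (- 1) h g; rewrite !scaleN1r ![- _ + _]addrC.
Qed.

Lemma compDl X Y Z (f : hom X Y) (g h : hom Y Z) :
  (g + h) \cmp f = g \cmp f + h \cmp f.
Proof. by have := comp_linearl f 1 g h; rewrite !scale1r. Qed.

Lemma compDr X Y Z (f : hom Y Z) (g h : hom X Y) :
  f \cmp (g + h) = f \cmp g + f \cmp h.
Proof. by have := comp_linearr f 1 g h; rewrite !scale1r. Qed.

Lemma mono0P X Y (f : hom X Y) :
  mono f <-> forall Z (g : hom Z X), f \cmp g = 0 -> g = 0.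
Proof.
split=> [fm Z g fg0|fm Z g h e]; first by apply: fm; rewrite comp0r.
by apply/eqP; rewrite -subr_eq0; apply/eqP/fm; rewrite compBr e subrr.
Qed.

Lemma epi0P X Y (f : hom X Y) :
  epi f <-> forall Z (g : hom Y Z), g \cmp f = 0 -> g = 0.
Proof.
split=> [fm Z g fg0|fm Z g h e]; first by apply: fm; rewrite comp0l.
by apply/eqP; rewrite -subr_eq0; apply/eqP/fm; rewrite compBl e subrr.
Qed.

Lemma ker_mono X Y K (f : hom X Y) (i : hom K X) : is_kernel f i -> mono i.
Proof.
move=> [fi0 ui] Z g h e.
have [|h' [_ u]] := ui _ (i \cmp h); first by rewrite compA fi0 comp0l.
by rewrite -(u h) // -(u g).
Qed.

Lemma coker_epi X Y Q (f : hom X Y) (p : hom Y Q) : is_cokernel f p -> epi p.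
Proof.
move=> [pf0 up] Z g h e.
have [|h' [_ u]] := up _ (h \cmp p); first by rewrite -compA pf0 comp0r.
by rewrite -(u h) // -(u g).
Qed.

Lemma ker_lift X Y K (f : hom X Y) (i : hom K X) Z (g : hom Z X) :
  is_kernel f i -> f \cmp g = 0 -> exists h, i \cmp h = g.
Proof. by move=> [_ u] /u[h [e _]]; exists h. Qed.

Lemma coker_desc X Y Q (f : hom X Y) (p : hom Y Q) Z (g : hom Y Z) :
  is_cokernel f p -> g \cmp f = 0 -> exists h, h \cmp p = g.
Proof. by move=> [_ u] /u[h [e _]]; exists h. Qed.

Lemma kerI X Y K (f : hom X Y) (i : hom K X) : mono i -> f \cmp i = 0 ->
  (forall Z (g : hom Z X), f \cmp g = 0 -> exists h, i \cmp h = g) ->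
  is_kernel f i.
Proof.
move=> im fi0 l; split=> // Z g /l[h e]; exists h; split=> // h' e'.
by apply: im; rewrite e e'.
Qed.

Lemma cokerI X Y Q (f : hom X Y) (p : hom Y Q) : epi p -> p \cmp f = 0 ->
  (forall Z (g : hom Y Z), g \cmp f = 0 -> exists h, h \cmp p = g) ->
  is_cokernel f p.
Proof.
move=> pe pf0 l; split=> // Z g /l[h e]; exists h; split=> // h' e'.
by apply: pe; rewrite e e'.
Qed.

Lemma mono_ker_coker X Y Q (i : hom X Y) (p : hom Y Q) :
  mono i -> is_cokernel i p -> is_kernel p i.
Proof.
move=> im ip; have [Z [g gi]] := abelian_mono (abelianP A) im.
apply: kerI => // [|T x px0]; first by case: ip.
have [h hp] := coker_desc ip gi.1.
by apply: (ker_lift gi); rewrite -hp -compA px0 comp0r.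
Qed.

Lemma epi_coker_ker X Y K (p : hom X Y) (i : hom K X) :
  epi p -> is_kernel p i -> is_cokernel i p.
Proof.
move=> pe pi; have [Z [g gp]] := abelian_epi (abelianP A) pe.
apply: cokerI => // [|T x xi0]; first by case: pi.
have [h ih] := ker_lift pi gp.1.
by apply: (coker_desc gp); rewrite -ih compA xi0 comp0l.
Qed.

Lemma image_ex X Y (f : hom X Y) :
  exists I (i : hom I Y) (p : hom X I), [/\ mono i, epi p & f = i \cmp p].
Proof.
have [Q [c fc]] := abelian_cokernel (abelianP A) f.
have [I [i ci]] := abelian_kernel (abelianP A) c.
have [p ip] := ker_lift ci fc.1.
have im := ker_mono ci.
exists I, i, p; split=> //; apply/epi0P => Z g gp0.
have [K [m gm]] := abelian_kernel (abelianP A) g.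
have mm := ker_mono gm.
have [p' mp'] := ker_lift gm gp0.
have imm : mono (i \cmp m).
  by move=> T x y; rewrite -!compA => /im /mm.
have [T [h hk]] := abelian_mono (abelianP A) imm.
have [h' hc] : exists h', h' \cmp c = h.
  by apply: (coker_desc fc); rewrite -ip -mp' !compA -[h \cmp i \cmp m]compA hk.1 comp0l.
have [n imn] : exists n, i \cmp m \cmp n = i.
  by apply: (ker_lift hk); rewrite -hc -compA ci.1 comp0r.
have mn : m \cmp n = idm I by apply: im; rewrite compA imn comp_idr.
by rewrite -[g]comp_idr -mn compA gm.1 comp0l.
Qed.

Lemma pullback_ex X Y Z (f : hom X Z) (g : hom Y Z) :
  exists P (p1 : hom P X) (p2 : hom P Y), [/\ f \cmp p1 = g \cmp p2,
    (forall T (x : hom T X) (y : hom T Y), f \cmp x = g \cmp y ->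
      exists z, p1 \cmp z = x /\ p2 \cmp z = y)
    & forall T (z : hom T P), p1 \cmp z = 0 -> p2 \cmp z = 0 -> z = 0].
Proof.
have [B [i1 [i2 [q1 [q2 [e11 e22 e12 e21 eB]]]]]] :=
  abelian_biproduct (abelianP A) X Y.
have [P [j mj]] := abelian_kernel (abelianP A) (f \cmp q1 - g \cmp q2).
exists P, (q1 \cmp j), (q2 \cmp j); split.
- by apply/eqP; rewrite -subr_eq0 !compA -compBl mj.1.
- move=> T x y e; have [|z jz] := ker_lift (g := i1 \cmp x + i2 \cmp y) mj.
    rewrite compBl !compDr -!compA ![q1 \cmp (_ \cmp _)]compA.
    rewrite ![q2 \cmp (_ \cmp _)]compA e11 e12 e21 e22.
    by rewrite !comp_idl !comp0l !comp0r addr0 add0r e subrr.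
  exists z; rewrite -!compA jz !compDr !compA e11 e12 e21 e22.
  by rewrite !comp_idl !comp0l addr0 add0r.
- move=> T z; rewrite -!compA => z1 z2; apply: (ker_mono mj).
  rewrite -[j \cmp z]comp_idl -eB compDl -!compA z1 z2.
  by rewrite !comp0r addr0.
Qed.

Lemma pullback_epi X Y Z P (f : hom X Z) (g : hom Y Z)
    (p1 : hom P X) (p2 : hom P Y) : epi f ->
  (forall T (x : hom T X) (y : hom T Y), f \cmp x = g \cmp y ->
      exists z, p1 \cmp z = x /\ p2 \cmp z = y) ->
  epi p2.
Proof.
move=> /epi0P fe up; apply/epi0P => T h hp0.
have [B [i1 [i2 [q1 [q2 [e11 e22 e12 e21 eB]]]]]] :=
  abelian_biproduct (abelianP A) X Y.
have [K [j mj]] := abelian_kernel (abelianP A) (f \cmp q1 - g \cmp q2).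
have mi1 : (f \cmp q1 - g \cmp q2) \cmp i1 = f.
  by rewrite compBl -!compA e11 e21 comp_idr comp0r subr0.
have me : epi (f \cmp q1 - g \cmp q2).
  by apply/epi0P => U u u0; apply: fe; rewrite -mi1 compA u0 comp0l.
have [|z [_ z2]] := up _ (q1 \cmp j) (q2 \cmp j).
  by apply/eqP; rewrite -subr_eq0 !compA -compBl mj.1.
have [|l lm] := coker_desc (g := h \cmp q2) (epi_coker_ker me mj).
  by rewrite -compA -z2 compA hp0 comp0l.
have l0 : l = 0 by apply: fe; rewrite -mi1 compA lm -compA e21 comp0r.
by rewrite -[h]comp_idr -e22 compA -lm l0 !comp0l.
Qed.

End AbelianFacts.

Section QuotientHom.
Variables (k : fieldType) (A : abelian_category k) (C : serre_subcategory A).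
Implicit Types M N X Y Z : A.

(* [i] is (the inclusion of) a subobject M' of M with M/M' in [C]. *)
Definition cosub X M (i : hom X M) : Prop :=
  mono i /\ exists Q (p : hom M Q), is_cokernel i p /\ C Q.

(* [q] is (the projection to) a quotient N/N' of N with N' in [C]. *)
Definition coquo N Y (q : hom N Y) : Prop :=
  epi q /\ exists K (j : hom K N), is_kernel q j /\ C K.

(* An element of some Hom(M', N/N') of the inductive system. *)
Record qrep M N := QRep {
  qsub : A; qin : hom qsub M; qinP : cosub qin;
  qquo : A; qpr : hom N qquo; qprP : coquo qpr;
  qmap : hom qsub qquo }.

(* Two elements are identified in the (filtered) colimit iff they have the same
   image in Hom(M'', N/N'') for some smaller M'' and some larger N''.  The
   system is filtered, so this also describes the colimit of vector spaces; only
   the underlying set is needed, the monoidal structures on the quotient not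
   being assumed linear. *)
Definition qeq M N (r r' : qrep M N) : Prop :=
  exists (X : A) (i : hom X M) (a : hom X (qsub r)) (a' : hom X (qsub r'))
         (Y : A) (q : hom N Y) (b : hom (qquo r) Y) (b' : hom (qquo r') Y),
    [/\ cosub i, qin r \cmp a = i & qin r' \cmp a' = i] /\
    [/\ coquo q, b \cmp qpr r = q & b' \cmp qpr r' = q] /\
    b \cmp qmap r \cmp a = b' \cmp qmap r' \cmp a'.

HB.instance Definition _ M N := gen_eqMixin (qrep M N).
HB.instance Definition _ M N := gen_choiceMixin (qrep M N).

Lemma ker_cosub X Y Z (g : hom Y Z) (i : hom X Y) :
  C Z -> is_kernel g i -> cosub i.
Proof.
move=> CZ gi; have [I [m [e [mm ee ge]]]] := image_ex g.
split; first exact: ker_mono gi.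
exists I, e; split; last exact: serre_sub mm CZ.
apply: epi_coker_ker => //; apply: kerI; first exact: ker_mono gi.
  by apply: mm; rewrite compA -ge gi.1 comp0r.
by move=> T x ex0; apply: (ker_lift gi); rewrite ge -compA ex0 comp0r.
Qed.

Lemma coker_coquo X Y Z (g : hom X Y) (q : hom Y Z) :
  C X -> is_cokernel g q -> coquo q.
Proof.
move=> CX gq; have [I [m [e [mm ee ge]]]] := image_ex g.
split; first exact: coker_epi gq.
exists I, m; split; last exact: serre_quo ee CX.
apply: mono_ker_coker => //; apply: cokerI; first exact: coker_epi gq.
  by apply: ee; rewrite -compA -ge gq.1 comp0l.
by move=> T x xm0; apply: (coker_desc gq); rewrite ge compA xm0 comp0l.
Qed.

Lemma coquo_local X Y Z (t : hom Y Z) (z : hom X Y) :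
  coquo t -> t \cmp z = 0 -> exists X' (w : hom X' X), cosub w /\ z \cmp w = 0.
Proof.
move=> [_ [K [j [tj CK]]]] tz; have [z' jz] := ker_lift tj tz.
have [X' [w wz]] := abelian_kernel (abelianP A) z'.
exists X', w; split; first exact: ker_cosub wz.
by rewrite -jz -compA wz.1 comp0r.
Qed.

Lemma cosub_comp X Y Z (v : hom X Y) (w : hom Y Z) :
  cosub v -> cosub w -> cosub (w \cmp v).
Proof.
move=> [vm [Qv [cv [vcv CQv]]]] [wm [Qw [cw [wcw CQw]]]].
split; first by move=> T x y; rewrite -!compA => /wm /vm.
have [Q [c cK]] := abelian_cokernel (abelianP A) (w \cmp v).
exists Q, c; split=> //.
have [e ec] : exists e, e \cmp c = cw.
  by apply: (coker_desc cK); rewrite compA wcw.1 comp0l.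
have ee : epi e.
  by move=> T x y exy; apply: (coker_epi wcw); rewrite -ec !compA exy.
have [K [kap eK]] := abelian_kernel (abelianP A) e.
have [u ku] : exists u, kap \cmp u = c \cmp w.
  by apply: (ker_lift eK); rewrite compA ec wcw.1.
have kw := mono_ker_coker wm wcw.
have ue : epi u.
  apply: (pullback_epi (f := c) (g := kap) (p1 := w)); first exact: coker_epi cK.
  move=> T x y cxy; have [|z wz] := ker_lift (g := x) kw.
    by rewrite -ec -compA cxy compA eK.1 comp0l.
  exists z; split=> //; apply: (ker_mono eK).
  by rewrite compA ku -compA wz.
have uv0 : u \cmp v = 0.
  by apply: (ker_mono eK); rewrite compA ku -compA cK.1 comp0r.
have [u' uu] := coker_desc vcv uv0.
apply: (@serre_ext _ _ C _ _ _ kap e) => //.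
  by split=> //; apply: epi_coker_ker.
apply: (@serre_quo _ _ C _ _ u') => // T x y exy.
by apply: ue; rewrite -uu !compA exy.
Qed.

Lemma cosub_id X : cosub (idm X).
Proof.
have [Z Z0] := abelian_zero (abelianP A).
have [[p [_ _]] _] := Z0 X; have [_ [q [_ uq]]] := Z0 X.
split; first by move=> T x y; rewrite !comp_idl.
exists Z, q; split; last exact: serre_zero.
have q0 : q = 0 by apply: uq.
apply: cokerI => [T x y _|//|T g].
- have [[z [_ uz]] _] := Z0 T.
  by rewrite -(uz x I) -(uz y I).
- by rewrite q0 comp0l.
- by rewrite comp_idr => ->; exists 0; rewrite comp0l.
Qed.

Lemma coquo_id X : coquo (idm X).
Proof.
have [Z Z0] := abelian_zero (abelianP A).
have [[p [_ up]] _] := Z0 X.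
split; first by move=> T x y; rewrite !comp_idr.
exists Z, p; split; last exact: serre_zero.
have p0 : p = 0 by apply: up.
apply: kerI => [T x y _|//|T g].
- have [_ [z [_ uz]]] := Z0 T.
  by rewrite -(uz x I) -(uz y I).
- by rewrite p0 comp0r.
- by rewrite comp_idl => ->; exists 0; rewrite comp0r.
Qed.

(* Covers are composites of morphisms of the above two kinds; they become
   isomorphisms in the quotient. *)
Inductive cover : forall X Y, hom X Y -> Prop :=
| cover_id X : cover (idm X)
| cover_sub X Y Z (w : hom Y Z) (c : hom X Y) :
    cover w -> cosub c -> cover (w \cmp c)
| cover_quo X Y Z (w : hom Y Z) (c : hom X Y) :
    cover w -> coquo c -> cover (w \cmp c).

Lemma cosub_cover X Y (c : hom X Y) : cosub c -> cover c.
Proof. by move=> h; rewrite -[c]comp_idl; apply: cover_sub => //; apply: cover_id. Qed.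

Lemma coquo_cover X Y (c : hom X Y) : coquo c -> cover c.
Proof. by move=> h; rewrite -[c]comp_idl; apply: cover_quo => //; apply: cover_id. Qed.

Lemma cover_comp X Y Z (v : hom X Y) (w : hom Y Z) :
  cover v -> cover w -> cover (w \cmp v).
Proof.
move=> cv; elim: cv Z w => {X Y v} [X|X Y Z v c _ IH cc|X Y Z v c _ IH cc] T w cw.
- by rewrite comp_idr.
- by rewrite compA; apply: cover_sub => //; apply: IH.
- by rewrite compA; apply: cover_quo => //; apply: IH.
Qed.

Lemma coquo_pullback X Y Z (c : hom Z Y) (f : hom X Y) : coquo c ->
  exists X' (w' : hom X' X) (g : hom X' Z),
    [/\ coquo w', f \cmp w' = c \cmp g & epi w'].
Proof.
move=> [ce [K [j [cj CK]]]].
have [P [p1 [p2 [e up ju]]]] := pullback_ex c f.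
have p2e := pullback_epi ce up.
exists P, p2, p1; split=> //; split=> //.
have [K' [j' pj]] := abelian_kernel (abelianP A) p2.
exists K', j'; split=> //.
have [m jm] : exists m, j \cmp m = p1 \cmp j'.
  by apply: (ker_lift cj); rewrite compA e -compA pj.1 comp0r.
apply: (@serre_sub _ _ C _ _ m) => //; apply/mono0P => T x mx0.
apply: (ker_mono pj); rewrite comp0r; apply: ju.
  by rewrite compA -jm -compA mx0 comp0r.
by rewrite compA pj.1 comp0l.
Qed.

Lemma cover_pullback X Y Z (w : hom Z Y) (f : hom X Y) : cover w ->
  exists X' (w' : hom X' X) (g : hom X' Z), cover w' /\ f \cmp w' = w \cmp g.
Proof.
move=> cw; elim: cw X f => {Y Z w} [Y|Z T Y w c _ IH cc|Z T Y w c _ IH cc] X f.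
- by exists X, (idm X), f; rewrite comp_idl comp_idr; split=> //; apply: cover_id.
- have [X1 [w1 [g [cw1 e1]]]] := IH _ f.
  case: (cc) => cm [Q [p [cp CQ]]].
  have [X2 [w2 kw2]] := abelian_kernel (abelianP A) (p \cmp g).
  have [|h ch] := ker_lift (g := g \cmp w2) (mono_ker_coker cm cp).
    by rewrite compA kw2.1.
  exists X2, (w1 \cmp w2), h; split.
    by apply: cover_sub => //; apply: ker_cosub CQ kw2.
  by rewrite compA e1 -!compA ch.
- have [X1 [w1 [g [cw1 e1]]]] := IH _ f.
  have [X2 [w2 [h [cw2 e2 _]]]] := coquo_pullback g cc.
  exists X2, (w1 \cmp w2), h; split; first exact: cover_quo.
  by rewrite compA e1 -!compA e2.
Qed.

Lemma cover_image X Y (w : hom X Y) : cover w ->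
  exists I (i : hom I Y) (p : hom X I), [/\ cosub i, epi p & w = i \cmp p].
Proof.
elim=> {X Y w} [X|X Y Z w c _ [I [i [p [ci pe ->]]]] [cm [Q [h [ch CQ]]]]
  |X Y Z w c _ [I [i [p [ci pe ->]]]] [ce _]].
- exists X, (idm X), (idm X); split; rewrite ?comp_idl //.
    exact: cosub_id.
  by move=> T x y; rewrite !comp_idr.
- have [J [j [p' [jm pe' e]]]] := image_ex (p \cmp c).
  exists J, (i \cmp j), p'; split=> //; last by rewrite -!compA -e.
  apply: cosub_comp => //; split=> //.
  have [R [d jd]] := abelian_cokernel (abelianP A) j.
  exists R, d; split=> //.
  have [|u uh] := coker_desc (g := d \cmp p) ch.
    by rewrite -compA e compA jd.1 comp0l.
  apply: (@serre_quo _ _ C _ _ u) => // T x y exy.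
  by apply: (coker_epi jd); apply: pe; rewrite -!compA -uh !compA exy.
- exists I, i, (p \cmp c); split=> //; last by rewrite compA.
  by move=> T x y; rewrite !compA => /ce /pe.
Qed.

(* A morphism M --> N of the quotient is determined by the pairs
   (x : X --> M, y : X --> N) of morphisms of [A] such that its composite with
   the image of x is the image of y. *)
Definition corr M N := forall X, hom X M -> hom X N -> Prop.

Record is_corr M N (P : corr M N) : Prop := IsCorr {
  corr_stable : forall X X' (u : hom X' X) (x : hom X M) (y : hom X N),
    P X x y -> P X' (x \cmp u) (y \cmp u);
  corr_local : forall X X' (w : hom X' X) (x : hom X M) (y : hom X N),
    cover w -> P X' (x \cmp w) (y \cmp w) -> P X x y;
  corr_functional : forall X (x : hom X M) (y y' : hom X N),
    P X x y -> P X x y' ->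
    exists X' (w : hom X' X), cover w /\ y \cmp w = y' \cmp w;
  corr_total : forall X (x : hom X M),
    exists X' (w : hom X' X) (y : hom X' N), cover w /\ P X' (x \cmp w) y }.

Lemma corr_sub M N (P P' : corr M N) S (s : hom S M) (f : hom S N) :
  is_corr P -> is_corr P' -> cover s -> P S s f -> P' S s f ->
  forall X x y, P X x y -> P' X x y.
Proof.
move=> cP cP' cs Psf Psf' X x y Pxy.
have [X1 [w [a [cw e]]]] := cover_pullback x cs.
have h1 := corr_stable cP a Psf; have h2 := corr_stable cP w Pxy.
rewrite e in h2; have [X2 [v [cv ev]]] := corr_functional cP h2 h1.
apply: (corr_local cP' (w := w \cmp v)); first exact: cover_comp.
rewrite !compA ev e; apply: (corr_stable cP'); exact: (corr_stable cP').
Qed.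

Lemma corr_eq M N (P P' : corr M N) S (s : hom S M) (f : hom S N) :
  is_corr P -> is_corr P' -> cover s -> P S s f -> P' S s f -> P = P'.
Proof.
move=> cP cP' cs h h'; apply: functional_extensionality_dep => X.
apply/funext => x; apply/funext => y; apply/propext; split.
  exact: corr_sub cs h h' _ _ _.
exact: corr_sub cs h' h _ _ _.
Qed.

Definition corr_id M : corr M M := fun X x y =>
  exists X' (w : hom X' X), cover w /\ x \cmp w = y \cmp w.

Definition corr_comp M N R (Q : corr N R) (P : corr M N) : corr M R :=
  fun X x z => exists X' (w : hom X' X) y,
    [/\ cover w, P X' (x \cmp w) y & Q X' y (z \cmp w)].

Lemma corr_compI M N R (Q : corr N R) (P : corr M N) X (x : hom X M) y z :
  P X x y -> Q X y z -> corr_comp Q P x z.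
Proof.
by move=> h1 h2; exists X, (idm X), y; rewrite !comp_idr; split=> //; apply: cover_id.
Qed.

Lemma is_corr_comp M N R (Q : corr N R) (P : corr M N) :
  is_corr Q -> is_corr P -> is_corr (corr_comp Q P).
Proof.
move=> cQ cP; split.
- move=> X X' u x z [X1 [w [y [cw h1 h2]]]].
  have [X2 [w' [v [cw' e]]]] := cover_pullback u cw.
  exists X2, w', (y \cmp v); split=> //.
    by rewrite -compA e compA; apply: (corr_stable cP).
  by rewrite -compA e compA; apply: (corr_stable cQ).
- move=> X X' w x z cw [X1 [w' [y [cw' h1 h2]]]].
  exists X1, (w \cmp w'), y; rewrite !compA; split=> //.
  exact: cover_comp.
- move=> X x z z' [X1 [w [y [cw h1 h2]]]] [X1' [w' [y' [cw' h1' h2']]]].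
  have [X2 [a [b [ca e]]]] := cover_pullback w cw'.
  have h3 := corr_stable cP a h1; have h3' := corr_stable cP b h1'.
  rewrite -compA e compA in h3.
  have [X3 [u [cu eu]]] := corr_functional cP h3 h3'.
  have h4 := corr_stable cQ u (corr_stable cQ a h2).
  have h4' := corr_stable cQ u (corr_stable cQ b h2').
  rewrite eu in h4.
  have [X4 [t [ct et]]] := corr_functional cQ h4 h4'.
  exists X4, (w \cmp a \cmp u \cmp t); split.
    by do !apply: cover_comp => //.
  by rewrite !compA et -![z' \cmp _ \cmp _]compA e !compA.
- move=> X x.
  have [X1 [w [y [cw h]]]] := corr_total cP x.
  have [X2 [w' [z [cw' h']]]] := corr_total cQ y.
  exists X2, (w \cmp w'), z; split; first exact: cover_comp.
  apply: corr_compI h'; rewrite compA; exact: (corr_stable cP).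
Qed.

Lemma corr_compA M N R S (P : corr R S) (Q : corr N R) (T : corr M N) :
  is_corr P -> is_corr Q -> is_corr T ->
  corr_comp P (corr_comp Q T) = corr_comp (corr_comp P Q) T.
Proof.
move=> cP cQ cT.
have [X1 [w1 [y [cw1 h1]]]] := corr_total cT (idm M).
have [X2 [w2 [z [cw2 h2]]]] := corr_total cQ y.
have [X3 [w3 [t [cw3 h3]]]] := corr_total cP z.
have g1 := corr_stable cT w3 (corr_stable cT w2 h1).
have g2 := corr_stable cQ w3 h2.
apply: (corr_eq (s := idm M \cmp w1 \cmp w2 \cmp w3) (f := t)).
- by do !apply: is_corr_comp.
- by do !apply: is_corr_comp.
- by rewrite comp_idl; do !apply: cover_comp => //.
- by apply: corr_compI h3; apply: corr_compI g1 g2.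
- by apply: corr_compI g1 _; apply: corr_compI g2 h3.
Qed.

(* The correspondence of T(qpr r)^-1 T(qmap r) T(qin r)^-1. *)
Definition qrep_corr M N (r : qrep M N) : corr M N := fun X x y =>
  exists X' (w : hom X' X) (a : hom X' (qsub r)),
    [/\ cover w, x \cmp w = qin r \cmp a
      & qpr r \cmp (y \cmp w) = qmap r \cmp a].

Lemma is_corr_qrep M N (r : qrep M N) : is_corr (qrep_corr r).
Proof.
split.
- move=> X X' u x y [X1 [w [a [cw h1 h2]]]].
  have [X2 [w' [v [cw' e]]]] := cover_pullback u cw.
  exists X2, w', (a \cmp v); split=> //.
    by rewrite -compA e compA h1 compA.
  by rewrite -[y \cmp u \cmp w']compA e !compA -h2 !compA.
- move=> X X' w x y cw [X1 [w' [a [cw' h1 h2]]]].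
  exists X1, (w \cmp w'), a; rewrite !compA in h1 h2 *; split=> //.
  exact: cover_comp.
- move=> X x y y' [X1 [w [a [cw h1 h2]]]] [X1' [w' [a' [cw' h1' h2']]]].
  have [X2 [v [v' [cv e]]]] := cover_pullback w cw'.
  have ea : a \cmp v = a' \cmp v'.
    apply: (qinP r).1; rewrite !compA -h1 -h1' -!compA e //.
  have [|X3 [u [cu eu]]] :=
    coquo_local (z := y \cmp w \cmp v - y' \cmp w \cmp v) (qprP r).
    rewrite compBr -[y' \cmp w \cmp v]compA e !compA.
    by rewrite !compA in h2 h2'; rewrite h2 h2' -!compA ea subrr.
  exists X3, (w \cmp v \cmp u); split.
    by do !apply: cover_comp => //; apply: cosub_cover.
  move/eqP: eu; rewrite compBl subr_eq0 => /eqP.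
  by rewrite !compA.
- move=> X x.
  have [X1 [w [a [cw e]]]] := cover_pullback x (cosub_cover (qinP r)).
  have [X2 [w' [y [cw' e' _]]]] := coquo_pullback (qmap r \cmp a) (qprP r).
  exists X2, (w \cmp w'), y; split; first by apply: cover_quo.
  exists X2, (idm X2), (a \cmp w'); rewrite !comp_idr; split.
  + exact: cover_id.
  + by rewrite compA e compA.
  + by rewrite -e' compA.
Qed.

Lemma qeq_corr M N (r r' : qrep M N) : qeq r r' -> qrep_corr r = qrep_corr r'.
Proof.
move=> [X [i [a [a' [Y [q [b [b' [[ci ea ea'] [[cq eb eb'] e]]]]]]]]]].
have [X1 [w [y [cw h]]]] := corr_total (is_corr_qrep r) i.
have [X2 [w' [a1 [cw' h1 h2]]]] := h.
have ea1 : a1 = a \cmp (w \cmp w').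
  by apply: (qinP r).1; rewrite -h1 -ea -!compA.
have e1 : q \cmp (y \cmp w') = b' \cmp (qmap r' \cmp a' \cmp (w \cmp w')).
  by rewrite -eb -compA h2 ea1 !compA; rewrite e.
have [X3 [w3 [z [cw3 ez _]]]] :=
  coquo_pullback (qmap r' \cmp a' \cmp (w \cmp w')) (qprP r').
have [|X4 [w4 [cw4 e4]]] := coquo_local (z := y \cmp w' \cmp w3 - z) cq.
  by rewrite compBr [q \cmp (_ \cmp w3)]compA e1 -eb' -!compA -ez -!compA subrr.
move/eqP: e4; rewrite compBl subr_eq0 => /eqP e4.
pose v := w' \cmp w3 \cmp w4.
have cv : cover v.
  by apply: cover_sub => //; apply: cover_quo.
have ey : y \cmp v = z \cmp w4 by rewrite /v !compA e4.
apply: (corr_eq (s := i \cmp w \cmp v) (f := y \cmp v)).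
- exact: is_corr_qrep.
- exact: is_corr_qrep.
- by do !apply: cover_comp => //; apply: cosub_cover.
- exact: (corr_stable (is_corr_qrep r)).
- exists X4, (idm X4), (a' \cmp w \cmp v); split.
  + exact: cover_id.
  + by rewrite comp_idr !compA ea'.
  + by rewrite comp_idr ey compA -ez /v !compA.
Qed.

Lemma corr_qeq M N (r r' : qrep M N) : qrep_corr r = qrep_corr r' -> qeq r r'.
Proof.
move=> err.
have [X1 [w1 [y1 [cw1 e1 w1e]]]] := coquo_pullback (qmap r) (qprP r).
have : qrep_corr r (qin r \cmp w1) y1.
  exists X1, (idm X1), w1; rewrite !comp_idr; split=> //; exact: cover_id.
rewrite err => -[X2 [w [a' [cw h1 h2]]]].
have cs : cover (qin r \cmp w1 \cmp w).
  do !apply: cover_comp => //; first exact: coquo_cover.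
  exact: cosub_cover (qinP r).
have [I [i [p [ci pe ei]]]] := cover_image cs.
have [K [kp kpP]] := abelian_kernel (abelianP A) p.
have pcK := epi_coker_ker pe kpP.
have [al eal] : exists al, al \cmp p = w1 \cmp w.
  apply: (coker_desc pcK); apply: (qinP r).1.
  by rewrite !compA ei -compA kpP.1 !comp0r.
have [al' eal'] : exists al', al' \cmp p = a'.
  apply: (coker_desc pcK); apply: (qinP r').1.
  by rewrite compA -h1 ei -compA kpP.1 !comp0r.
have iE : qin r \cmp al = i by apply: pe; rewrite -compA eal compA ei.
have iE' : qin r' \cmp al' = i by apply: pe; rewrite -compA eal' -h1 ei.
have [te [K1 [j1 [k1 CK1]]]] := qprP r.
have [te' [K2 [j2 [k2 CK2]]]] := qprP r'.
have [B [b1 [b2 [p1 [p2 bP]]]]] := abelian_biproduct (abelianP A) K1 K2.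
have CB := serre_biproduct bP CK1 CK2; case: bP => e11 e22 e12 e21 eB.
have [Y [q qP]] := abelian_cokernel (abelianP A) (j1 \cmp p1 + j2 \cmp p2).
have [|b eb] := coker_desc (g := q) (epi_coker_ker te k1).
  have -> : j1 = (j1 \cmp p1 + j2 \cmp p2) \cmp b1.
    by rewrite compDl -!compA e11 e21 comp_idr comp0r addr0.
  by rewrite compA qP.1 comp0l.
have [|b' eb'] := coker_desc (g := q) (epi_coker_ker te' k2).
  have -> : j2 = (j1 \cmp p1 + j2 \cmp p2) \cmp b2.
    by rewrite compDl -!compA e22 e12 comp_idr comp0r add0r.
  by rewrite compA qP.1 comp0l.
exists I, i, al, al', Y, q, b, b'; split; first by split.
split; first by split=> //; apply: coker_coquo qP.
apply: pe; rewrite -!compA eal eal' -h2 [qmap r \cmp (_ \cmp _)]compA e1.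
by rewrite !compA eb eb'.
Qed.

Lemma corr_qrep_ex M N (P : corr M N) : is_corr P ->
  exists r : qrep M N, qrep_corr r = P.
Proof.
move=> cP; have [S [s [f [cs h]]]] := corr_total cP (idm M).
rewrite comp_idl in h.
have [I [i [p [ci pe e]]]] := cover_image cs.
have [K [j pj]] := abelian_kernel (abelianP A) p.
have sj0 : s \cmp j = 0 by rewrite e -compA pj.1 comp0r.
have := corr_stable cP j h; have := corr_stable cP (0 : hom K S) h.
rewrite sj0 !comp0r => h0 /(corr_functional cP h0)[X [w [cw]]].
rewrite comp0l => /esym fjw.
have [J [i' [p' [[_ [Q [c [i'c CQ]]]] pe' ew]]]] := cover_image cw.
have [l lc] : exists l, l \cmp c = f \cmp j.
  apply: (coker_desc i'c); apply: pe'.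
  by rewrite -compA -ew fjw comp0l.
have [Y [q lq]] := abelian_cokernel (abelianP A) l.
have [g gp] : exists g, g \cmp p = q \cmp f.
  apply: (coker_desc (epi_coker_ker pe pj)).
  by rewrite -compA -lc compA lq.1 comp0l.
exists (QRep ci (coker_coquo CQ lq) g).
apply: (corr_eq (s := s) (f := f)) => //; first exact: is_corr_qrep.
by exists S, (idm S), p; rewrite !comp_idr; split=> //; exact: cover_id.
Qed.

Section QeqEquiv.
Variables M N : A.

Definition qeqb (r r' : qrep M N) : bool := `[< qeq r r' >].

Lemma qeqbP r r' : reflect (qrep_corr r = qrep_corr r') (qeqb r r').
Proof. by apply: (iffP (asboolP _)); [exact: qeq_corr|exact: corr_qeq]. Qed.

Lemma qeqb_refl : reflexive qeqb.
Proof. by move=> r; apply/qeqbP. Qed.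

Lemma qeqb_sym : symmetric qeqb.
Proof. by move=> r r'; apply/qeqbP/qeqbP => ->. Qed.

Lemma qeqb_trans : transitive qeqb.
Proof. by move=> r r' r'' /qeqbP e /qeqbP e'; apply/qeqbP; rewrite e. Qed.

Canonical qeqb_equiv := EquivRel qeqb qeqb_refl qeqb_sym qeqb_trans.

(* Hom(M, N) in the quotient: the colimit of the Hom(M', N/N'). *)
Definition qhom : Type := {eq_quot qeqb}.

End QeqEquiv.

(* The class of an element f of Hom(M', N/N'). *)
Definition qclass M N M' N'' (s : hom M' M) (sP : cosub s)
    (f : hom M' N'') (t : hom N N'') (tP : coquo t) : qhom M N :=
  \pi_({eq_quot (@qeqb M N)}) (QRep sP tP f).

Definition qhom_corr M N (phi : qhom M N) : corr M N :=
  qrep_corr (repr (phi : {eq_quot (@qeqb M N)})).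

Lemma qhom_corr_pi M N (r : qrep M N) :
  qhom_corr (\pi_({eq_quot (@qeqb M N)}) r) = qrep_corr r.
Proof. by apply/qeqbP; rewrite -eqmodE reprK. Qed.

Lemma is_corr_qhom M N (phi : qhom M N) : is_corr (qhom_corr phi).
Proof. exact: is_corr_qrep. Qed.

Lemma qhom_corr_inj M N (phi psi : qhom M N) :
  qhom_corr phi = qhom_corr psi -> phi = psi.
Proof.
move=> e; rewrite -[phi](reprK (qT := {eq_quot (@qeqb M N)})).
rewrite -[psi](reprK (qT := {eq_quot (@qeqb M N)})).
by apply/eqP; rewrite eqmodE; apply/qeqbP.
Qed.

Lemma qcomp_ex M N R (psi : qhom N R) (phi : qhom M N) :
  exists chi : qhom M R,
    qhom_corr chi = corr_comp (qhom_corr psi) (qhom_corr phi).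
Proof.
have [r e] := corr_qrep_ex (is_corr_comp (is_corr_qhom psi) (is_corr_qhom phi)).
by exists (\pi_({eq_quot (@qeqb M R)}) r); rewrite qhom_corr_pi.
Qed.

Definition qcomp M N R (psi : qhom N R) (phi : qhom M N) : qhom M R :=
  projT1 (cid (qcomp_ex psi phi)).

Lemma qcompE M N R (psi : qhom N R) (phi : qhom M N) :
  qhom_corr (qcomp psi phi) = corr_comp (qhom_corr psi) (qhom_corr phi).
Proof. exact: projT2 (cid (qcomp_ex psi phi)). Qed.

(* The canonical functor on morphisms: M' = M and N' = 0. *)
Definition qfmap M N (f : hom M N) : qhom M N :=
  qclass (cosub_id M) f (coquo_id N).

Lemma qclassI M N M' N'' (s : hom M' M) (sP : cosub s)
    (f : hom M' N'') (t : hom N N'') (tP : coquo t) X (a : hom X M') y :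
  t \cmp y = f \cmp a -> qhom_corr (qclass sP f tP) (s \cmp a) y.
Proof.
rewrite qhom_corr_pi => e; exists X, (idm X), a.
by rewrite !comp_idr; split=> //; exact: cover_id.
Qed.

Lemma qfmapI M N (f : hom M N) X (x : hom X M) :
  qhom_corr (qfmap f) x (f \cmp x).
Proof. by rewrite -[x]comp_idl; apply: qclassI; rewrite !comp_idl. Qed.

Lemma qhom_eq M N (phi psi : qhom M N) S (s : hom S M) (f : hom S N) :
  cover s -> qhom_corr phi s f -> qhom_corr psi s f -> phi = psi.
Proof.
by move=> cs h h'; apply: qhom_corr_inj; apply: corr_eq cs h h';
  exact: is_corr_qhom.
Qed.

Lemma qcompI M N R (psi : qhom N R) (phi : qhom M N) X
    (x : hom X M) (y : hom X N) (z : hom X R) :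
  qhom_corr phi x y -> qhom_corr psi y z -> qhom_corr (qcomp psi phi) x z.
Proof. by rewrite qcompE; apply: corr_compI. Qed.

Lemma qcompA M N R S (h : qhom R S) (g : qhom N R) (f : qhom M N) :
  qcomp h (qcomp g f) = qcomp (qcomp h g) f.
Proof.
by apply: qhom_corr_inj; rewrite !qcompE corr_compA //; exact: is_corr_qhom.
Qed.

Lemma qcomp_idl M N (f : qhom M N) : qcomp (qfmap (idm N)) f = f.
Proof.
have [S [s [y [cs h]]]] := corr_total (is_corr_qhom f) (idm M).
rewrite comp_idl in h; apply: (qhom_eq cs _ h); apply: (qcompI h).
by rewrite -{2}[y]comp_idl; apply: qfmapI.
Qed.

Lemma qcomp_idr M N (f : qhom M N) : qcomp f (qfmap (idm M)) = f.
Proof.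
have [S [s [y [cs h]]]] := corr_total (is_corr_qhom f) (idm M).
rewrite comp_idl in h; apply: (qhom_eq cs _ h); apply: (qcompI _ h).
by rewrite -{2}[s]comp_idl; apply: qfmapI.
Qed.

Lemma qfmap_comp M N R (g : hom N R) (f : hom M N) :
  qfmap (g \cmp f) = qcomp (qfmap g) (qfmap f).
Proof.
apply: (qhom_eq (s := idm M) (f := g \cmp f \cmp idm M)).
- exact: cover_id.
- exact: qfmapI.
- by apply: qcompI; [exact: qfmapI|rewrite -compA; exact: qfmapI].
Qed.

Definition quotient_category : category :=
  @Category A qhom (fun M => qfmap (idm M)) qcomp qcomp_idl qcomp_idr qcompA.

Definition quotient_functor : functor A quotient_category :=
  @Functor A quotient_category (fun M => M) qfmap (fun M => erefl) qfmap_comp.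

(* The next three lemmas determine the composition of [quotient_category]: the
   class of f : M' --> N/N' is T(t)^-1 T(f) T(s)^-1. *)
Lemma quotient_functor_cosub M' M (s : hom M' M) :
  cosub s -> is_iso (fmap quotient_functor s).
Proof.
move=> sP; exists (qclass sP (idm M') (coquo_id M')); split.
- apply: (qhom_eq (s := idm M') (f := idm M')); first exact: cover_id.
    apply: qcompI; first exact: qfmapI.
    by apply: qclassI; rewrite comp_idl.
  by rewrite -{2}[idm M']comp_idl; apply: qfmapI.
- apply: (qhom_eq (s := s) (f := s)); first exact: cosub_cover.
    apply: (qcompI (y := idm M')); last first.
      by rewrite -{2}[s]comp_idr; apply: qfmapI.
    by rewrite -[X in qhom_corr _ X]comp_idr; apply: qclassI; rewrite comp_idl.
  by rewrite -{2}[s]comp_idl; apply: qfmapI.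
Qed.

Lemma quotient_functor_coquo N N'' (t : hom N N'') :
  coquo t -> is_iso (fmap quotient_functor t).
Proof.
move=> tP; exists (qclass (cosub_id N'') (idm N'') tP); split.
- apply: (qhom_eq (s := idm N) (f := idm N)); first exact: cover_id.
    apply: qcompI; first exact: qfmapI.
    rewrite comp_idr -[X in qhom_corr _ X]comp_idl.
    by apply: qclassI; rewrite comp_idl comp_idr.
  by rewrite -{2}[idm N]comp_idl; apply: qfmapI.
- apply: (qhom_eq (s := t) (f := t)); first exact: coquo_cover.
    apply: (qcompI (y := idm N)); last first.
      by rewrite -{2}[t]comp_idr; apply: qfmapI.
    by rewrite -[X in qhom_corr _ X]comp_idl; apply: qclassI; rewrite comp_idl comp_idr.
  by rewrite -{2}[t]comp_idl; apply: qfmapI.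
Qed.

Lemma qclassE M N M' N'' (s : hom M' M) (sP : cosub s)
    (f : hom M' N'') (t : hom N N'') (tP : coquo t) :
  qcomp (qfmap t) (qcomp (qclass sP f tP) (qfmap s)) = qfmap f.
Proof.
have [X [w [y [cw e _]]]] := coquo_pullback f tP.
apply: (qhom_eq (s := w) (f := f \cmp w)).
- exact: coquo_cover.
- rewrite e; apply: qcompI; last exact: qfmapI.
  by apply: qcompI; [exact: qfmapI|exact: qclassI].
- exact: qfmapI.
Qed.

End QuotientHom.

(* Main.v *)
Require Import Defs.
From mathcomp Require Import all_boot all_algebra.
From mathcomp Require Import boolp.
Import Defs.

Set Implicit Arguments.
Unset Strict Implicit.
Unset Printing Implicit Defensive.

Import GRing.Theory.
Local Open Scope ring_scope.
Local Open Scope cat_scope.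

(** Write [1] for the unit object, and [T] for the canonical functor to A/C.

    The kernel of a monoidal functor is a tensor ideal, and a tensor category
    has no Serre tensor ideals besides the two trivial ones, because its unit
    object is simple.

    If [X] is in [C], then [T] inverts the zero map from [X] to a zero object
    [Z].  Tensoring with [T Y] preserves isomorphisms, so [T] also inverts the
    map from [Y ⊗ X] to [Y ⊗ Z].  As [Y ⊗ Z] is zero, [Y ⊗ X] is in [C]
    ([serre_tens]).

    Simplicity of [1] ([unit_simple]) comes from the equality [End 1 = k].  Let
    [q : 1 -> S] be a simple quotient, which exists since [1] has finite
    length, and let [D] be a left dual of [S].  The transpose [q' : D -> 1] of
    [q] is a monomorphism, hence so is [q' ⊗ S : D ⊗ S -> S].  Its source is
    nonzero because evaluation on it is, so it is an isomorphism as [S] is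
    simple.  Evaluation thus becomes a nonzero map [S -> 1], and its composite
    with [q] is a nonzero scalar: [q] is split and therefore invertible
    ([simple_quotient_unit]).

    Now let [X] be a nonzero object of [C], with left dual [D].  Evaluation
    [D ⊗ X -> 1] is nonzero, hence an epimorphism onto the simple object [1],
    so [1] is in [C], and with it every [Y], which is isomorphic to
    [Y ⊗ 1]. *)

(** * Isomorphisms, monomorphisms and epimorphisms *)

Section Isomorphisms.
Variable C : category.
Implicit Types X Y Z : C.

Lemma retraction_mono X Y (f : hom X Y) (r : hom Y X) : r \cmp f = idm X -> mono f.
Proof. by move=> rf Z g h e; rewrite -[g]comp_idl -[h]comp_idl -rf -!compA e. Qed.

Lemma section_epi X Y (f : hom X Y) (s : hom Y X) : f \cmp s = idm Y -> epi f.
Proof. by move=> fs Z g h e; rewrite -[g]comp_idr -[h]comp_idr -fs !compA e. Qed.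

Lemma fwd_mono X Y (u : iso X Y) : mono u.
Proof. exact: retraction_mono (fwdK u). Qed.

Lemma fwd_epi X Y (u : iso X Y) : epi u.
Proof. exact: section_epi (bwdK u). Qed.

Lemma bwd_epi X Y (u : iso X Y) : epi (bwd u).
Proof. exact: section_epi (fwdK u). Qed.

Lemma is_iso_mono X Y (f : hom X Y) : is_iso f -> mono f.
Proof. by case=> g [gf _]; exact: retraction_mono gf. Qed.

Lemma mono_comp X Y Z (g : hom Y Z) (f : hom X Y) : mono g -> mono f -> mono (g \cmp f).
Proof. by move=> gm fm T x y; rewrite -!compA => /gm /fm. Qed.

End Isomorphisms.

(** * Duals and exactness of the tensor product *)

Section Transposition.
Variables (C : category) (M : monoidal C).
Implicit Types X Y Z V W : C.
Local Notation "X ⊗ Y" := (tens M X Y) (at level 38, left associativity).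
Local Notation "f ⊠ g" := (tensm M f g) (at level 38, left associativity).
Local Notation "1" := (munit M).

Lemma tensm_compl X Y Z V (g : hom Y Z) (f : hom X Y) :
  (g \cmp f) ⊠ idm V = (g ⊠ idm V) \cmp (f ⊠ idm V).
Proof. by rewrite -tensm_comp comp_idl. Qed.

Lemma tensm_compr X Y Z V (g : hom Y Z) (f : hom X Y) :
  idm V ⊠ (g \cmp f) = (idm V ⊠ g) \cmp (idm V ⊠ f).
Proof. by rewrite -tensm_comp comp_idl. Qed.

Lemma tensm_exchange X X' Y Y' (f : hom X X') (g : hom Y Y') :
  (f ⊠ idm Y') \cmp (idm X ⊠ g) = (idm X' ⊠ g) \cmp (f ⊠ idm Y).
Proof. by rewrite -!tensm_comp !comp_idl !comp_idr. Qed.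

Lemma assoc_bwd_nat X X' Y Y' Z Z' (f : hom X X') (g : hom Y Y') (h : hom Z Z') :
  (f ⊠ g ⊠ h) \cmp bwd (assoc M X Y Z) =
  bwd (assoc M X' Y' Z') \cmp (f ⊠ (g ⊠ h)).
Proof.
apply: (fwd_mono (u := assoc M X' Y' Z')); rewrite !compA assoc_nat bwdK comp_idl.
by rewrite -compA bwdK comp_idr.
Qed.

Lemma tensm_unitr_inj X Y (f g : hom X Y) : f ⊠ idm 1 = g ⊠ idm 1 -> f = g.
Proof. by move=> e; apply: (fwd_epi (u := runit M X)); rewrite -!runit_nat e. Qed.

Lemma tensm_unitl_inj X Y (f g : hom X Y) : idm 1 ⊠ f = idm 1 ⊠ g -> f = g.
Proof. by move=> e; apply: (fwd_epi (u := lunit M X)); rewrite -!lunit_nat e. Qed.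

Lemma tensm_unitr_mono X Y (f : hom X Y) : mono f -> mono (f ⊠ idm 1).
Proof.
move=> fm Z g h e; apply: (fwd_mono (u := runit M X)); apply: fm.
by rewrite !compA -runit_nat -!compA e.
Qed.

Lemma tensm_unitl_epi X Y (f : hom X Y) : epi f -> epi (idm 1 ⊠ f).
Proof.
move=> fe Z g h e; apply: (bwd_epi (u := lunit M Y)); apply: fe.
have bn : bwd (lunit M Y) \cmp f = (idm 1 ⊠ f) \cmp bwd (lunit M X).
  apply: (fwd_mono (u := lunit M Y)).
  by rewrite !compA bwdK comp_idl lunit_nat -compA bwdK comp_idr.
by rewrite -!compA bn !compA e.
Qed.

(** A map into a dual [Y] of [X] is determined by its pairing with [X]: the
    coevaluation allows it to be recovered from the pairing, by the zigzag
    identity. *)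
Lemma transpose_inj X Y (ev : hom (Y ⊗ X) 1) (coev : hom 1 (X ⊗ Y)) Z (g h : hom Z Y) :
  lunit M Y \cmp (ev ⊠ idm Y) \cmp bwd (assoc M Y X Y)
    \cmp (idm Y ⊠ coev) = runit M Y ->
  ev \cmp (g ⊠ idm X) = ev \cmp (h ⊠ idm X) -> g = h.
Proof.
move=> zz e; apply: (fwd_epi (u := runit M Z)).
have key (f : hom Z Y) : f \cmp runit M Z = lunit M Y
    \cmp ((ev \cmp (f ⊠ idm X)) ⊠ idm Y) \cmp bwd (assoc M Z X Y) \cmp (idm Z ⊠ coev).
  rewrite -runit_nat -zz -!compA -tensm_exchange tensm_compl -!compA.
  by rewrite [((f ⊠ _) ⊠ _) \cmp (_ \cmp _)]compA assoc_bwd_nat tensm_id -compA.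
by rewrite !key e.
Qed.

(** Since [Z] is a left dual of [V], tensoring on the right with [V] is left
    adjoint to tensoring on the right with [Z], which therefore preserves
    monomorphisms.  The proof uses the injectivity of the adjunction map
    [Hom(W, X ⊗ Z) -> Hom(W ⊗ V, X)]; keeping [X ⊗ 1] instead of [X] as target
    keeps the right unit constraint of a tensor product out of the
    computation. *)
Lemma tensr_mono V Z X Y (f : hom X Y) :
  is_left_dual M V Z -> mono f -> mono (f ⊠ idm Z).
Proof.
move=> [ev [coev [_ zz]]] fm W g h e.
pose tr (g : hom W (X ⊗ Z)) := (idm X ⊠ ev) \cmp assoc M X Z V \cmp (g ⊠ idm V).
have etr : tr g = tr h.
  apply: (tensm_unitr_mono fm); rewrite /tr !compA !tensm_exchange.
  rewrite -![_ \cmp (f ⊠ _) \cmp _]compA -tensm_id -!assoc_nat -!compA.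
  by rewrite -!tensm_compl e.
pose th := (ev ⊠ idm Z) \cmp bwd (assoc M Z V Z) \cmp (idm Z ⊠ coev).
have thE : lunit M Z \cmp th = runit M Z by rewrite /th !compA.
have thm : mono (idm X ⊠ th).
  apply: (retraction_mono (r := idm X ⊠ (bwd (runit M Z) \cmp lunit M Z))).
  by rewrite -tensm_compr -compA thE fwdK tensm_id.
have pent : assoc M X (Z ⊗ V) Z \cmp (assoc M X Z V ⊠ idm Z)
    \cmp bwd (assoc M (X ⊗ Z) V Z)
    = (idm X ⊠ bwd (assoc M Z V Z)) \cmp assoc M X Z (V ⊗ Z).
  apply: (fwd_epi (u := assoc M (X ⊗ Z) V Z)); rewrite -!compA fwdK comp_idr.
  by rewrite pentagon !compA -tensm_compr fwdK tensm_id comp_idl.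
have nat_coev := assoc_nat M (idm X) (idm Z) coev; rewrite tensm_id in nat_coev.
have nat_ev := assoc_nat M (idm X) ev (idm Z).
(* The transpose of [t] determines the composite of [t ⊠ idm 1] with a
   monomorphism, hence [t]. *)
have key (t : hom W (X ⊗ Z)) :
    assoc M X 1 Z \cmp (tr t ⊠ idm Z) \cmp bwd (assoc M W V Z) \cmp (idm W ⊠ coev)
    = (idm X ⊠ th) \cmp assoc M X Z 1 \cmp (t ⊠ idm 1).
  have nat_t : ((t ⊠ idm V) ⊠ idm Z) \cmp (bwd (assoc M W V Z) \cmp (idm W ⊠ coev))
      = bwd (assoc M (X ⊗ Z) V Z) \cmp (idm _ ⊠ coev) \cmp (t ⊠ idm 1).
    by rewrite compA assoc_bwd_nat tensm_id -!compA tensm_exchange.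
  rewrite /th !tensm_compr /tr !tensm_compl -!compA nat_t !compA nat_ev.
  congr (_ \cmp _); rewrite -[_ \cmp assoc M X Z 1]compA -nat_coev !compA.
  congr (_ \cmp _); rewrite -[_ \cmp assoc M X Z _]compA -pent -!compA.
  done.
have eqt := key g; rewrite etr key in eqt.
apply: tensm_unitr_inj; apply: (fwd_mono (u := assoc M X Z 1)); apply: thm.
by rewrite !compA -eqt.
Qed.

(** The mirror image of [tensr_mono]: tensoring on the left with [V] is
    right adjoint to tensoring on the left with [Z], which therefore preserves
    epimorphisms. *)
Lemma tensl_epi Z V X Y (f : hom X Y) :
  is_left_dual M V Z -> epi f -> epi (idm Z ⊠ f).
Proof.
move=> [ev [coev [_ zz]]] fe W g h e.
pose tr (g : hom (Z ⊗ Y) W) := (idm V ⊠ g) \cmp assoc M V Z Y \cmp (coev ⊠ idm Y).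
have etr : tr g = tr h.
  apply: (tensm_unitl_epi fe); rewrite /tr -!compA !tensm_exchange.
  rewrite ![assoc M V Z Y \cmp _]compA -tensm_id !assoc_nat !compA.
  by rewrite -!tensm_compr e.
pose th := (ev ⊠ idm Z) \cmp bwd (assoc M Z V Z) \cmp (idm Z ⊠ coev).
have thE : lunit M Z \cmp th = runit M Z by rewrite /th !compA.
have the : epi (th ⊠ idm Y).
  apply: (section_epi (s := (bwd (runit M Z) \cmp lunit M Z) ⊠ idm Y)).
  rewrite -tensm_compl; set u := th \cmp _.
  suff -> : u = idm _ by rewrite tensm_id.
  apply: (fwd_mono (u := lunit M Z)).
  by rewrite /u compA thE compA bwdK comp_idl comp_idr.
have pent : bwd (assoc M Z V (Z ⊗ Y)) \cmp (idm Z ⊠ assoc M V Z Y)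
    = assoc M (Z ⊗ V) Z Y \cmp (bwd (assoc M Z V Z) ⊠ idm Y)
      \cmp bwd (assoc M Z (V ⊗ Z) Y).
  apply: (fwd_mono (u := assoc M Z V (Z ⊗ Y))).
  rewrite !compA bwdK comp_idl pentagon -!compA.
  rewrite [(assoc M Z V Z ⊠ _) \cmp _]compA -tensm_compl bwdK tensm_id.
  by rewrite comp_idl bwdK comp_idr.
have nat_coev := assoc_bwd_nat (idm Z) coev (idm Y).
have nat_ev := assoc_nat M ev (idm Z) (idm Y); rewrite tensm_id in nat_ev.
(* The transpose of [t] determines the composite of an epimorphism with
   [idm 1 ⊠ t], hence [t]. *)
have key (t : hom (Z ⊗ Y) W) :
    (ev ⊠ idm W) \cmp bwd (assoc M Z V W) \cmp (idm Z ⊠ tr t)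
      \cmp assoc M Z 1 Y
    = (idm 1 ⊠ t) \cmp assoc M 1 Z Y \cmp (th ⊠ idm Y).
  have nat_t : (ev ⊠ idm W) \cmp bwd (assoc M Z V W) \cmp (idm Z ⊠ (idm V ⊠ t))
      = (idm 1 ⊠ t) \cmp ((ev ⊠ idm _) \cmp bwd (assoc M Z V (Z ⊗ Y))).
    by rewrite -!compA -assoc_bwd_nat tensm_id !compA tensm_exchange.
  rewrite /th !tensm_compl /tr !tensm_compr !compA nat_t -!compA.
  congr (_ \cmp _).
  rewrite [RHS]compA nat_ev -!compA; congr (_ \cmp _).
  rewrite [LHS]compA pent -!compA; congr (_ \cmp (_ \cmp _)).
  by rewrite compA -nat_coev -compA fwdK comp_idr.
have eqt := key g; rewrite etr key in eqt.
apply: tensm_unitl_inj; apply: (fwd_epi (u := assoc M 1 Z Y)); apply: the.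
by rewrite eqt.
Qed.

End Transposition.

(** * The kernel of a monoidal quotient functor *)

Section TensorIdeal.
Variables (k : fieldType) (A : abelian_category k).
Implicit Types X Y Z : A.

Lemma zero_ob_idP X : is_zero_ob X <-> idm X = 0.
Proof.
split=> [X0|X0 Y].
  by have [[f [_ u]] _] := X0 X; rewrite -(u (idm X) I) -(u 0 I).
split; exists 0; split=> // f _.
  by rewrite -[f]comp_idr X0 comp0r.
by rewrite -[f]comp_idl X0 comp0l.
Qed.

Lemma epi_zero_ob X Y (f : hom X Y) : epi f -> is_zero_ob X -> is_zero_ob Y.
Proof.
move=> fe /zero_ob_idP X0; apply/zero_ob_idP/fe.
by rewrite -[f]comp_idr X0 !comp0r.
Qed.

Variables (M : monoidal A) (bM : bilinear_tensor M).

Lemma tensm0r X X' Y Y' (f : hom X X') : tensm M f (0 : hom Y Y') = 0.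
Proof.
have := bM.2 X X' Y Y' f (-1) 0 0.
by rewrite !scaleN1r oppr0 addr0 addNr.
Qed.

Lemma tensm0l X X' Y Y' (g : hom Y Y') : tensm M (0 : hom X X') g = 0.
Proof.
have := bM.1 X X' Y Y' g (-1) 0 0.
by rewrite !scaleN1r oppr0 addr0 addNr.
Qed.

Lemma tens_zero_obr X Y : is_zero_ob Y -> is_zero_ob (tens M X Y).
Proof. by move/zero_ob_idP=> Y0; apply/zero_ob_idP; rewrite -tensm_id Y0 tensm0r. Qed.

Lemma tens_zero_obl X Y : is_zero_ob X -> is_zero_ob (tens M X Y).
Proof. by move/zero_ob_idP=> X0; apply/zero_ob_idP; rewrite -tensm_id X0 tensm0l. Qed.

(** The zigzag identity factors the identity of [X] through the evaluation. *)
Lemma zero_ev_zero_ob X Y (ev : hom (tens M Y X) (munit M)) (coev : hom (munit M) (tens M X Y)) :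
  runit M X \cmp tensm M (idm X) ev \cmp assoc M X Y X
    \cmp tensm M coev (idm X) = lunit M X ->
  ev = 0 -> is_zero_ob X.
Proof.
move=> zz ev0; apply/zero_ob_idP; apply: (fwd_epi (u := lunit M X)).
by rewrite -zz ev0 tensm0r !comp0r !comp0l comp0r.
Qed.

Variable C : serre_subcategory A.

Lemma quotient_functor_zero X Z (f : hom X Z) :
  C X -> is_zero_ob Z -> is_iso (fmap (quotient_functor C) f).
Proof.
move=> CX Z0; apply: quotient_functor_coquo; move/zero_ob_idP: (Z0) => id0.
have f0 : f = 0 by rewrite -[f]comp_idl id0 comp0l.
split; first by apply/epi0P => T g _; rewrite -[g]comp_idr id0 comp0r.
exists X, (idm X); split=> //; apply: kerI.
- by move=> T g h; rewrite !comp_idl.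
- by rewrite f0 comp0l.
- by move=> T g _; exists g; rewrite comp_idl.
Qed.

(** If [T] inverts a map from [X] to a zero object, it identifies the identity
    of [X] with [0]; these then agree on a cover of [X], so that the zero
    subobject of [X] has its quotient in [C]. *)
Lemma quotient_functor_iso_zero X Z (f : hom X Z) :
  is_zero_ob Z -> is_iso (fmap (quotient_functor C) f) -> C X.
Proof.
move=> /zero_ob_idP Z0 /is_iso_mono fm.
have f0 : f = 0 by rewrite -[f]comp_idl Z0 comp0l.
have e : fmap (quotient_functor C) (idm X) = fmap (quotient_functor C) 0.
  by apply: fm; rewrite -!fmap_comp comp0r f0 comp0l.
have h1 := qfmapI C (idm X) (idm X); have h0 := qfmapI C (0 : hom X X) (idm X).
rewrite -[qfmap C 0]e comp0l in h0; rewrite comp_idl in h1.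
have [T [w [cw]]] := corr_functional (is_corr_qhom _) h1 h0.
rewrite comp_idl comp0l => w0.
have [I [i [p [[im [Q [c [ic CQ]]]] pe wip]]]] := cover_image cw.
have i0 : i = 0 by apply: pe; rewrite -wip w0 comp0l.
have [r rc] : exists r, r \cmp c = idm X.
  by apply: (coker_desc ic); rewrite i0 comp0r.
exact: serre_sub (retraction_mono rc) CQ.
Qed.

(** Tensoring with [T Y] preserves the isomorphism from [T X] to [T Z] for [Z]
    zero, and naturality of [mf_mul] turns the result into the image under [T]
    of a map from [Y ⊗ X] to the zero object [Y ⊗ Z]. *)
Lemma serre_tens (MQ : monoidal (quotient_category C))
    (MT : monoidal_functor M MQ (quotient_functor C)) X Y : C X -> C (tens M Y X).
Proof.
move=> CX; have [Z Z0] := abelian_zero (abelianP A).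
apply: (@quotient_functor_iso_zero _ _ (tensm M (idm Y) (0 : hom X Z))).
  exact: tens_zero_obr.
have [g [gf fg]] := quotient_functor_zero (0 : hom X Z) CX Z0.
set F := quotient_functor C in MT g gf fg *.
have nat := mf_mul_nat MT (idm Y) (0 : hom X Z).
exists (mf_mul MT Y X \cmp tensm MQ (idm _) g \cmp bwd (mf_mul MT Y Z)); split.
  apply: (fwd_epi (u := mf_mul MT Y X)).
  rewrite -!compA -nat [bwd _ \cmp _]compA fwdK comp_idl.
  by rewrite -tensm_comp fmap_id gf comp_idl tensm_id comp_idl comp_idr.
rewrite !compA -nat -[_ \cmp tensm MQ _ g]compA.
by rewrite -tensm_comp fmap_id fg comp_idl tensm_id comp_idr bwdK.
Qed.

End TensorIdeal.

(** * Simplicity of the unit object *)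

Section UnitSimple.
Variables (k : closedFieldType) (A : tensor_category k).
Local Notation M := (mt_mon A).

(** With [D] dual to [S], the composite of the inverse of [D ⊗ S -> S] and the
    evaluation is a nonzero map [S -> 1]; its composite with [q] is a nonzero
    scalar, so [q] is split. *)
Lemma simple_quotient_unit (S : A) (q : hom (munit M) S) :
  epi q -> simple S -> is_iso q.
Proof.
move=> qe [S0 Ssub].
have [D [ev [coev [zz1 zz2]]]] := (mt_rigid S).1.
have [V VS] := (mt_rigid S).2.
(* [q'] is the transpose of [q]; pairing turns postcomposition with [q'] into
   precomposition with the epimorphism [Z ⊗ q]. *)
pose q' := ev \cmp tensm M (idm D) q \cmp bwd (runit M D).
have q'm : mono q'.
  move=> Z g h e; have [W WZ] := (mt_rigid Z).2.
  have n (f : hom Z D) : q' \cmp f \cmp runit M Z =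
      ev \cmp tensm M f (idm S) \cmp tensm M (idm Z) q.
    rewrite -!compA tensm_exchange -runit_nat.
    by rewrite [bwd _ \cmp _]compA fwdK comp_idl.
  apply: (transpose_inj zz2); apply: (tensl_epi WZ qe).
  by rewrite -!n e.
have DS0 : ~ is_zero_ob (tens M D S).
  move/zero_ob_idP => DS0; apply: S0; apply: (zero_ev_zero_ob (mt_bilinear A) zz1).
  by rewrite -[ev]comp_idr DS0 comp0r.
pose j := lunit M S \cmp tensm M q' (idm S).
have [//|[r [rj jr]]] := Ssub _ j (mono_comp (fwd_mono (u := _)) (tensr_mono VS q'm)).
have [c [ec _]] := tc_end (ev \cmp r \cmp q).
have c0 : c != 0.
  apply/eqP => c0; apply: S0; apply: (zero_ev_zero_ob (mt_bilinear A) zz1).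
  apply: (section_epi rj); apply: qe.
  by rewrite ec c0 scale0r !comp0l.
pose s := c^-1 *: (ev \cmp r).
have sq : s \cmp q = idm _.
  have := comp_linearl q c^-1 (ev \cmp r) 0.
  by rewrite !addr0 comp0l addr0 ec scalerA mulVf // scale1r.
exists s; split=> //; apply: qe.
by rewrite -compA sq comp_idl comp_idr.
Qed.

Lemma unit_simple : ~ is_zero_ob (munit M) -> simple (munit M).
Proof.
move=> nz; have [S [q [qe sS]]] : exists S (q : hom (munit M) S), epi q /\ simple S.
  case: (mt_finite_length (munit M)) nz => [X X0 /(_ X0)//|X Y S i p [_ ip] sS _ _].
  by exists S, p; split=> //; exact: coker_epi ip.
have [r [rq qr]] := simple_quotient_unit qe sS.
split=> // J j jm.
have [|J0|[t [tj jt]]] := sS.2 _ (q \cmp j); first exact: mono_comp (retraction_mono rq) jm.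
  by left.
right; exists (t \cmp q); split; first by rewrite -compA.
by apply: (retraction_mono rq); rewrite comp_idr !compA jt comp_idl.
Qed.

End UnitSimple.

(** * Serre subcategories with monoidal quotient *)

Theorem proposition4p12 (k : closedFieldType) (A : tensor_category k)
    (C : serre_subcategory A)
    (MQ : monoidal (quotient_category C))
    (MT : monoidal_functor (mt_mon A) MQ (quotient_functor C)) :
  (forall X : A, C X -> is_zero_ob X) \/ (forall X : A, C X).
Proof.
have [h|] := pselect (forall X : A, C X -> is_zero_ob X); first by left.
move=> /existsNP[X /not_implyP[CX X0]]; right.
have bM := mt_bilinear A.
have [D [ev [coev [zz _]]]] := (mt_rigid X).1.
have CU : C (munit (mt_mon A)).
  have [I [i [p [im pe evE]]]] := image_ex ev.
  have CI : C I by apply: serre_quo pe _; exact: (serre_tens bM MT).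
  have [|_ /(_ I i im)[I0|[r [ri ir]]]] := @unit_simple k A.
  - move=> U0; apply: X0; apply: (epi_zero_ob (fwd_epi (u := lunit (mt_mon A) X))).
    exact: (tens_zero_obl bM).
  - case: X0; apply: (zero_ev_zero_ob bM zz); rewrite evE.
    by move/zero_ob_idP: I0 => I0; rewrite -[i]comp_idr I0 comp0r comp0l.
  - exact: serre_quo (section_epi ir) CI.
move=> Y; apply: (serre_quo (fwd_epi (u := runit (mt_mon A) Y))).
exact: (serre_tens bM MT).
Qed.
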